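(* The Chazy IX equation $$u'''=54u^4+72u^2u'+12(u')^2+\delta\qquad(\delta\in\mathbb{C})$$ is invariant under the birational transformation $g_0:(u;\delta)\mapsto(p;\tilde\delta)$ given by $$p=\frac{(\sqrt5-3)\left\{108u^4+18(5+\sqrt5)u^2u'+6(3+\sqrt5)(u')^2+3(\sqrt5-1)uu''+2\delta\right\}}{6(\sqrt5-1)\left\{3(\sqrt5-1)uu'+u''\right\}},\qquad \tilde\delta=\frac{7+3\sqrt5}{2}\,\delta .$$
   Context: Primes denote derivatives with respect to the complex variable $t$. Invariance means: if $u$ is a solution of the equation with parameter $\delta$, then, wherever the denominator is nonzero, $p$ is a solution of the same equation with $\delta$ replaced by $\tilde\delta$, i.e. $p'''=54p^4+72p^2p'+12(p')^2+\tilde\delta$. Birational means that the induced map $(u,u',u'')\mapsto(p,p',p'')$, with $p',p''$ expressed in terms of $u,u',u''$ by means of the equation for $u$, is a birational map. *)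

(* Defs.v *)
From mathcomp Require Import all_boot all_order all_algebra.
From mathcomp Require Import fraction generic_quotient.
From mathcomp Require Import all_classical all_reals all_analysis.
From mathcomp Require Import complex.
From mathcomp Require mpoly.
(* The notations of mpoly clash with those of mathcomp-analysis. *)
Import -(notations) mpoly.

Set Implicit Arguments.
Unset Strict Implicit.
Unset Printing Implicit Defensive.

Import Order.TTheory GRing.Theory Num.Theory.
Import numFieldNormedType.Exports.

Local Open Scope ring_scope.
Local Open Scope classical_set_scope.

(* R[i], seen as an abstract numClosedFieldType so that the normed-module
   structure of a numFieldType over itself (hence complex differentiation) is
   inferred. *)
Definition Cplx (R : realType) : numClosedFieldType := R[i].

(* The formulas are stated over an arbitrary ring or field: they are used both
   for complex numbers and for rational functions.  [u0], [u1], [u2] stand for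
   u, u', u'', [d] for delta and [s] for the square root of 5. *)
Definition chazyIX_rhs (A : comNzRingType) (d u0 u1 : A) : A :=
  54 * u0 ^+ 4 + 72 * u0 ^+ 2 * u1 + 12 * u1 ^+ 2 + d.

Definition g0_num (A : comNzRingType) (s d u0 u1 u2 : A) : A :=
  (s - 3) * (108 * u0 ^+ 4 + 18 * (5 + s) * u0 ^+ 2 * u1
             + 6 * (3 + s) * u1 ^+ 2 + 3 * (s - 1) * u0 * u2 + 2 * d).

Definition g0_den (A : comNzRingType) (s u0 u1 u2 : A) : A :=
  6 * (s - 1) * (3 * (s - 1) * u0 * u1 + u2).

Definition g0_p (F : fieldType) (s d u0 u1 u2 : F) : F :=
  g0_num s d u0 u1 u2 / g0_den s u0 u1 u2.

Definition g0_delta (F : fieldType) (s d : F) : F := (7 + 3 * s) / 2 * d.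

(* [derivable _ t 1] is differentiability at t in the variable of K, that is
   complex differentiability when K is [Cplx R]. *)
Definition chazyIX_solution (K : numFieldType) (d : K) (U : set K)
    (u : K -> K) : Prop :=
  open U /\
  forall t, U t ->
    [/\ derivable u t 1, derivable (derive1n 1 u) t 1,
        derivable (derive1n 2 u) t 1
      & derive1n 3 u t = chazyIX_rhs d (u t) (derive1n 1 u t)].

Definition g0_fun (K : numFieldType) (s d : K) (u : K -> K) (t : K) : K :=
  g0_p s d (u t) (derive1n 1 u t) (derive1n 2 u t).

(* The points where the denominator of [g0_fun s d u] is nonzero. *)
Definition g0_dom (K : numFieldType) (s : K) (u : K -> K) : set K :=
  [set t | g0_den s (u t) (derive1n 1 u t) (derive1n 2 u t) != 0].

Section RationalMaps.
Variable F : fieldType.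

Definition ratfun (n : nat) := {fraction (mpoly n F)}.

Definition ratX (n : nat) (i : 'I_n) : ratfun n :=
  FracField.tofrac (mpolyX F (mnm1 i)).

Definition ratC (n : nat) (c : F) : ratfun n :=
  FracField.tofrac (mpolyC n c).

(* A family P : 'I_m -> ratfun n is a rational map from affine n-space to
   affine m-space; [poly_comp P h] and [rat_comp P f] are the pullbacks of h
   and f along P. *)
Definition poly_comp (m n : nat) (P : 'I_m -> ratfun n) (h : mpoly m F) :
    ratfun n :=
  mmap (@ratC n) P h.

Definition rat_comp (m n : nat) (P : 'I_m -> ratfun n) (f : ratfun m) :
    ratfun n :=
  poly_comp P (repr f).1 / poly_comp P (repr f).2.

(* No nonzero polynomial vanishes on the image: the image is Zariski dense.
   This is what makes [rat_comp P] independent of the chosen fractions. *)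
Definition dominant (m n : nat) (P : 'I_m -> ratfun n) : Prop :=
  forall h : mpoly m F, h != 0 -> poly_comp P h != 0.

Definition birational_map (n : nat) (P : 'I_n -> ratfun n) : Prop :=
  exists Q : 'I_n -> ratfun n,
    [/\ dominant P, dominant Q,
        forall i, rat_comp P (Q i) = ratX i
      & forall i, rat_comp Q (P i) = ratX i].

(* The coordinates 0, 1, 2 are u, u', u''. *)
Definition coord (k : nat) : 'I_3 := inord k.

(* Differentiation with respect to t along solutions, u''' being eliminated by
   means of the equation. *)
Definition chazyIX_poly_deriv (d : F) (h : mpoly 3 F) : mpoly 3 F :=
  let X k := mpolyX F (mnm1 (coord k)) in
  X 1 * mderiv (coord 0) h + X 2 * mderiv (coord 1) h
  + chazyIX_rhs (mpolyC 3 d) (X 0) (X 1) * mderiv (coord 2) h.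

Definition chazyIX_deriv (d : F) (f : ratfun 3) : ratfun 3 :=
  let a := (repr f).1 in
  let b := (repr f).2 in
  FracField.tofrac (chazyIX_poly_deriv d a * b - a * chazyIX_poly_deriv d b)
  / FracField.tofrac (b ^+ 2).

(* The map (u, u', u'') |-> (p, p', p''). *)
Definition g0_map (s d : F) (i : 'I_3) : ratfun 3 :=
  iter i (chazyIX_deriv d)
    (g0_p (ratC 3 s) (ratC 3 d)
       (ratX (coord 0)) (ratX (coord 1)) (ratX (coord 2))).

End RationalMaps.

(* Main.v *)
Require Import Defs.
From HB Require Import structures.
From mathcomp Require Import all_boot all_order all_algebra.
From mathcomp Require Import fraction generic_quotient.
From mathcomp Require Import all_classical all_reals all_analysis.
From mathcomp Require mpoly.
From mathcomp Require Import ring.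
Import -(notations) mpoly.
Import Order.TTheory GRing.Theory Num.Theory.
Import numFieldNormedType.Exports.
Local Open Scope ring_scope.
Local Open Scope classical_set_scope.

(** Write s for the square root of 5 and put, along a solution u,
      tau = u'' + 3 (s - 1) u u',   y = tau' / tau.
    The denominator of g0 is 6 (s - 1) tau, and its numerator is a combination
    of tau' and u tau, so that g0 is linear in u and y:
      p = (3 - s) / 2 * u + (1 - s) / 6 * y                            [g0_pE].
    Moreover tau satisfies a linear equation of the second order whose
    coefficients are polynomials in u and u' [ddtauE]; hence y satisfies the
    Riccati equation
      y' = - y^2 + 3 (s - 1) u y + (15 + 9 s) u' + 18 (1 + s) u^2.
    The successive derivatives of p are therefore polynomials in u, u', u'' and
    y, and delta can be eliminated by means of y tau = tau'.  That p solves the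
    equation with the new parameter is then a short polynomial identity
    [g0_lin_chazyIX].

    The same computation inverts g0.  Replace s by - s: the function tau formed
    with - s and p is the constant - (7 + 3 s) / 2 times the original tau
    [tau_g0_lin], so y is the same for u and for p.  Since
    u |-> (3 - s) / 2 * u + (1 - s) / 6 * y and its conjugate are inverse to each
    other when y is fixed, the transformation g0 for - s and the new parameter
    takes p back to u [g0_p_conj], and it takes the new parameter back to delta.

    These identities hold at a point where tau does not vanish, and in any
    differential field.  Complex differentiation turns them into the invariance
    statement.  The field of rational functions in u, u', u'', with the
    derivation that eliminates u''', turns them into the statement that the two
    maps (u, u', u'') |-> (p, p', p'') are inverse to each other.  For the latter,
    substitution of rational functions is handled as a partial ring morphism
    [specializes]; it commutes with the derivations by the chain rule, so that
    only the first coordinate has to be computed.  Dominance comes for free: if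
    every component of P can be evaluated along Q with result the coordinate,
    a polynomial that vanishes along P vanishes [specializes_dominant]. *)

Set Implicit Arguments.
Unset Strict Implicit.
Unset Printing Implicit Defensive.

(** * Identities satisfied by the tau function *)

Section Jets.
Variable A : comNzRingType.
Implicit Types s d u y : A.

Definition tau s u0 u1 u2 := 3 * (s - 1) * u0 * u1 + u2.

(** The first two derivatives of [tau] along a solution. *)
Definition dtau s d u0 u1 u2 :=
  3 * (s - 1) * (u1 ^+ 2 + u0 * u2) + chazyIX_rhs d u0 u1.

Definition ddtau s d u0 u1 u2 :=
  3 * (s - 1) * (3 * u1 * u2 + u0 * chazyIX_rhs d u0 u1)
  + (216 * u0 ^+ 3 * u1 + 144 * u0 * u1 ^+ 2 + 72 * u0 ^+ 2 * u2
     + 24 * u1 * u2).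

(** The right-hand side of the Riccati equation for y = tau' / tau, and its
    first two derivatives, which express y', y'' and y''' in terms of u and y. *)
Definition riccati1 s u0 u1 y :=
  - y ^+ 2 + 3 * (s - 1) * u0 * y + (15 + 9 * s) * u1 + 18 * (1 + s) * u0 ^+ 2.

Definition riccati2 s u0 u1 u2 y y1 :=
  - 2 * y * y1 + 3 * (s - 1) * (u1 * y + u0 * y1) + (15 + 9 * s) * u2
  + 36 * (1 + s) * u0 * u1.

Definition riccati3 s u0 u1 u2 u3 y y1 y2 :=
  - 2 * (y1 ^+ 2 + y * y2) + 3 * (s - 1) * (u2 * y + 2 * u1 * y1 + u0 * y2)
  + (15 + 9 * s) * u3 + 36 * (1 + s) * (u1 ^+ 2 + u0 * u2).

(** The linear equation of tau.  Comparing the terms in delta forces the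
    coefficient of tau'; the other one is then read off from the terms u' u''
    and u^2 u''. *)
Lemma ddtauE s d u0 u1 u2 : s ^+ 2 = 5 ->
  ddtau s d u0 u1 u2 =
  3 * (s - 1) * u0 * dtau s d u0 u1 u2
  + ((15 + 9 * s) * u1 + 18 * (1 + s) * u0 ^+ 2) * tau s u0 u1 u2.
Proof. by move=> hs; rewrite /ddtau /dtau /tau /chazyIX_rhs; ring: hs. Qed.

End Jets.

Definition g0_lin (F : fieldType) (s u y : F) :=
  (3 - s) / 2 * u + (1 - s) / 6 * y.

Section Identities.
Variables (F : fieldType) (s d u0 u1 u2 : F).
Hypotheses (hs : s ^+ 2 = 5) (h2 : (2 : F) != 0) (h3 : (3 : F) != 0).

Let h6 : (6 : F) != 0.
Proof. by rewrite (natrM F 2 3) mulf_neq0. Qed.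

Lemma sqrt5_neq1 : s - 1 != 0.
Proof.
have : (s - 1) * (s + 1) != 0.
  have -> : (s - 1) * (s + 1) = 2 * 2 by ring: hs.
  by rewrite mulf_neq0.
by rewrite mulf_eq0 negb_or => /andP[].
Qed.

Lemma g0_den_eq0 : (g0_den s u0 u1 u2 == 0) = (tau s u0 u1 u2 == 0).
Proof.
rewrite (_ : g0_den s u0 u1 u2 = 6 * (s - 1) * tau s u0 u1 u2) //.
by rewrite !mulf_eq0 (negPf h6) (negPf sqrt5_neq1).
Qed.

(** The braces in the numerator of g0 are 2 tau' - 3 (s - 1) u tau. *)
Lemma g0_pE : tau s u0 u1 u2 != 0 ->
  g0_p s d u0 u1 u2 = g0_lin s u0 (dtau s d u0 u1 u2 / tau s u0 u1 u2).
Proof.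
move=> t0.
have numE : g0_num s d u0 u1 u2
    = (s - 3) * (2 * dtau s d u0 u1 u2 - 3 * (s - 1) * u0 * tau s u0 u1 u2).
  by rewrite /g0_num /dtau /tau /chazyIX_rhs; ring: hs.
have hs1 := sqrt5_neq1.
rewrite /g0_p numE (_ : g0_den s u0 u1 u2 = 6 * (s - 1) * tau s u0 u1 u2) //.
rewrite /g0_lin.
by move: (dtau _ _ _ _ _) (tau _ _ _ _) t0 => n b b0; field: hs;
  rewrite b0 h6 h2 hs1.
Qed.

Section LogDerivative.
Variable y : F.
Hypothesis hy : y * tau s u0 u1 u2 = dtau s d u0 u1 u2.

Let u3 := chazyIX_rhs d u0 u1.
Let y1 := riccati1 s u0 u1 y.
Let y2 := riccati2 s u0 u1 u2 y y1.
Let y3 := riccati3 s u0 u1 u2 u3 y y1 y2.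
Let p0 := g0_lin s u0 y.
Let p1 := g0_lin s u1 y1.
Let p2 := g0_lin s u2 y2.

(* Once delta is eliminated in this way, u, u', u'' and y are independent, and
   the identities below hold between polynomials over Q(s). *)
Let dE : d = y * tau s u0 u1 u2 - 3 * (s - 1) * (u1 ^+ 2 + u0 * u2)
  - (54 * u0 ^+ 4 + 72 * u0 ^+ 2 * u1 + 12 * u1 ^+ 2).
Proof. by rewrite hy /dtau /chazyIX_rhs; ring. Qed.

Lemma g0_lin_chazyIX :
  g0_lin s u3 y3 = chazyIX_rhs (g0_delta s d) p0 p1.
Proof.
rewrite /p0 /p1 /y3 /y2 /y1 /u3 /g0_delta /g0_lin.
rewrite /riccati3 /riccati2 /riccati1 /chazyIX_rhs dE /tau.
by field: hs; rewrite h6 h2.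
Qed.

(** Up to a constant, [tau] is invariant under g0 combined with the conjugation
    of the square root of 5. *)
Lemma tau_g0_lin :
  tau (- s) p0 p1 p2 = - (7 + 3 * s) / 2 * tau s u0 u1 u2.
Proof.
rewrite /p2 /p0 /p1 /y2 /y1 /g0_lin /riccati2 /riccati1 /tau.
by field: hs; rewrite h6 h2.
Qed.

Lemma dtau_g0_lin : dtau (- s) (g0_delta s d) p0 p1 p2
  = - (7 + 3 * s) / 2 * dtau s d u0 u1 u2.
Proof.
rewrite /p2 /p0 /p1 /y2 /y1 /g0_delta /g0_lin /riccati2 /riccati1.
by rewrite /dtau /chazyIX_rhs dE /tau; field: hs; rewrite h6 h2.
Qed.

End LogDerivative.

Lemma conj_g0_lin u y : g0_lin (- s) (g0_lin s u y) y = u.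
Proof. by rewrite /g0_lin; field: hs; rewrite h6 h2. Qed.

Lemma g0_delta_conj : g0_delta (- s) (g0_delta s d) = d.
Proof. by rewrite /g0_delta; field: hs. Qed.

(** It is a unit of norm 1: its conjugate is its inverse. *)
Lemma g0_factor_neq0 : (7 + 3 * s) / 2 != 0.
Proof.
have : (7 + 3 * s) / 2 * ((7 - 3 * s) / 2) = 1 by field: hs.
move/(congr1 (fun x => x != 0)).
by rewrite oner_neq0 mulf_eq0 negb_or => /andP[].
Qed.

End Identities.

(** The conjugate transformation inverts g0, because y is the same for u and
    for its image. *)
Lemma g0_p_conj (F : fieldType) (s d u0 u1 u2 : F) :
  s ^+ 2 = 5 -> (2 : F) != 0 -> (3 : F) != 0 -> tau s u0 u1 u2 != 0 ->
  let y := dtau s d u0 u1 u2 / tau s u0 u1 u2 in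
  let y1 := riccati1 s u0 u1 y in
  let y2 := riccati2 s u0 u1 u2 y y1 in
  let p0 := g0_lin s u0 y in
  let p1 := g0_lin s u1 y1 in
  let p2 := g0_lin s u2 y2 in
  tau (- s) p0 p1 p2 != 0 /\ g0_p (- s) (g0_delta s d) p0 p1 p2 = u0.
Proof.
move=> hs h2 h3 t0 y y1 y2 p0 p1 p2.
have hy : y * tau s u0 u1 u2 = dtau s d u0 u1 u2 by rewrite divfK.
have c0 : - (7 + 3 * s) / 2 != 0.
  by rewrite mulNr oppr_eq0 g0_factor_neq0.
have te := tau_g0_lin u0 u1 u2 hs h2 h3 y.
have dte := dtau_g0_lin hs h2 h3 hy.
have pt0 : tau (- s) p0 p1 p2 != 0 by rewrite te mulf_neq0.
split=> //; rewrite g0_pE // ?sqrrN // te dte -mulf_div divff // mul1r.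
exact: conj_g0_lin.
Qed.

(** * Differentiation along solutions in a field with a derivation *)

Section Derivation.
Variables (L : fieldType) (del : L -> L).
Hypotheses (delD : {morph del : f g / f + g})
  (delM : forall f g, del (f * g) = del f * g + f * del g).

Lemma del0 : del 0 = 0.
Proof. by apply: (addrI (del 0)); rewrite -delD !addr0. Qed.

Lemma delN f : del (- f) = - del f.
Proof. by apply: (addrI (del f)); rewrite -delD !subrr del0. Qed.

Lemma del1 : del 1 = 0.
Proof.
by apply: (addrI (del 1)); rewrite addr0 -{3}[1]mulr1 delM mul1r mulr1.
Qed.

Lemma delnat n : del n%:R = 0.
Proof. by elim: n => [|n IHn]; rewrite ?del0 // -natr1 delD del1 IHn addr0. Qed.

Lemma delX f n : del (f ^+ n.+1) = n.+1%:R * f ^+ n * del f.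
Proof.
elim: n => [|n IHn]; first by rewrite expr1 expr0 !mul1r.
by rewrite exprS delM IHn !exprS -[n.+2%:R]natr1; ring.
Qed.

Lemma delV f : f != 0 -> del f^-1 = - del f / f ^+ 2.
Proof.
move=> f0; have : del (f * f^-1) = 0 by rewrite divff // del1.
rewrite delM => /eqP; rewrite addrC addr_eq0 => /eqP e.
by apply: (mulfI f0); rewrite e; field.
Qed.

Lemma del_quot f g :
  g != 0 -> del (f / g) = (del f * g - f * del g) / g ^+ 2.
Proof. by move=> g0; rewrite delM delV //; field. Qed.

Section Solution.
Variables s d u0 u1 u2 : L.
Hypotheses (dels : del s = 0) (deld : del d = 0).
Hypotheses (delu0 : del u0 = u1) (delu1 : del u1 = u2)
  (delu2 : del u2 = chazyIX_rhs d u0 u1).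
Hypotheses (hs : s ^+ 2 = 5) (h2 : (2 : L) != 0) (h3 : (3 : L) != 0).

Let delE :=
  (delN, delnat, dels, deld, delu0, delu1, delu2, delX, del1, delD, delM).

Lemma del_tau : del (tau s u0 u1 u2) = dtau s d u0 u1 u2.
Proof. by rewrite /tau /dtau !delE; ring. Qed.

Lemma del_dtau : del (dtau s d u0 u1 u2) = ddtau s d u0 u1 u2.
Proof.
by rewrite /dtau /ddtau {1}/chazyIX_rhs !delE /chazyIX_rhs; ring.
Qed.

Lemma del_riccati1 z z1 :
  del z = z1 -> del (riccati1 s u0 u1 z) = riccati2 s u0 u1 u2 z z1.
Proof. by move=> dz; rewrite /riccati2 /riccati1 !delE dz; ring. Qed.

Lemma del_riccati2 z z1 z2 : del z = z1 -> del z1 = z2 ->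
  del (riccati2 s u0 u1 u2 z z1)
  = riccati3 s u0 u1 u2 (chazyIX_rhs d u0 u1) z z1 z2.
Proof. by move=> dz dz1; rewrite /riccati3 /riccati2 !delE dz dz1; ring. Qed.

Lemma del_g0_lin f g : del (g0_lin s f g) = g0_lin s (del f) (del g).
Proof.
have h6 : (6 : L) != 0 by rewrite (natrM L 2 3) mulf_neq0.
have const c k : del c = 0 -> k%:R != 0 :> L -> del (c / k%:R) = 0.
  by move=> dc k0; rewrite del_quot // dc delnat mul0r mulr0 subrr mul0r.
rewrite /g0_lin delD !(delM (_ / _)) !const ?mul0r ?add0r //.
  by rewrite !delE oppr0 addr0.
by rewrite !delE oppr0 addr0.
Qed.

Hypothesis tau0 : tau s u0 u1 u2 != 0.

Lemma del_logtau : let y := dtau s d u0 u1 u2 / tau s u0 u1 u2 in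
  del y = riccati1 s u0 u1 y.
Proof.
rewrite /= del_quot // del_tau del_dtau ddtauE // /riccati1.
by move: (dtau _ _ _ _ _) (tau _ _ _ _) tau0 => n b b0; field.
Qed.

Lemma g0_p_derivation : let p k := iter k del (g0_p s d u0 u1 u2) in
  [/\ p 3%N = chazyIX_rhs (g0_delta s d) (p 0%N) (p 1%N),
      tau (- s) (p 0%N) (p 1%N) (p 2%N) != 0
    & g0_p (- s) (g0_delta s d) (p 0%N) (p 1%N) (p 2%N) = u0].
Proof.
move=> p; set y := dtau s d u0 u1 u2 / tau s u0 u1 u2.
set y1 := riccati1 s u0 u1 y; set y2 := riccati2 s u0 u1 u2 y y1.
set u3 := chazyIX_rhs d u0 u1; set y3 := riccati3 s u0 u1 u2 u3 y y1 y2.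
have e0 : p 0%N = g0_lin s u0 y by rewrite /p /= g0_pE.
have e1 : p 1%N = g0_lin s u1 y1.
  by rewrite (_ : p 1%N = del (p 0%N)) // e0 del_g0_lin delu0 del_logtau.
have dy1 : del y1 = y2 by apply: del_riccati1 del_logtau.
have e2 : p 2%N = g0_lin s u2 y2.
  by rewrite (_ : p 2%N = del (p 1%N)) // e1 del_g0_lin delu1 dy1.
have e3 : p 3%N = g0_lin s u3 y3.
  rewrite (_ : p 3%N = del (p 2%N)) // e2 del_g0_lin delu2; congr g0_lin.
  exact: del_riccati2 del_logtau dy1.
have [pt0 q0] := g0_p_conj d hs h2 h3 tau0.
rewrite e3 e2 e1 e0; split=> //.
by apply: g0_lin_chazyIX => //; rewrite divfK.
Qed.

End Solution.
End Derivation.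

(** * Invariance of the equation under g0 *)

Section Analytic.
Variable K : numFieldType.
Implicit Types (f g u : K -> K) (t : K) (W : set K).

Lemma is_derive1 f t : derivable f t 1 -> is_derive t (1 : K) f (derive1 f t).
Proof. by move=> /derivableP; rewrite derive1E. Qed.

(** The derivative at a point of an open set depends only on the values of the
    function on that set; the values of g0 outside its domain do not matter. *)
Lemma derive1_eq_on W f g g' : open W -> (forall t, W t -> f t = g t) ->
  (forall t, W t -> is_derive t (1 : K) g (g' t)) ->
  forall t, W t -> derivable f t 1 /\ derive1 f t = g' t.
Proof.
move=> Wo fg dg t Wt.
have : \forall x \near t, g x = f x.
  have Wnbhs : nbhs t W by exact: open_nbhs_nbhs.
  by apply: filterS Wnbhs => x Wx; rewrite fg.
move=> /near_eq_is_derive /(_ (dg t Wt)) [df <-].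
by rewrite derive1E.
Qed.

Lemma is_derive_quot f g (df dg t : K) : g t != 0 ->
  is_derive t (1 : K) f df -> is_derive t (1 : K) g dg ->
  is_derive t (1 : K) (fun x => f x / g x) ((df * g t - f t * dg) / g t ^+ 2).
Proof.
move=> gt0 Hf Hg.
have HV : is_derive t (1 : K) (fun x => (g x)^-1) (- (g t) ^- 2 * dg).
  apply: DeriveDef; first by apply: derivableV => //; exact: ex_derive.
  by rewrite deriveV // derive_val.
apply: (is_derive_eq (is_deriveM Hf HV)).
by rewrite /GRing.scale /=; field.
Qed.

Lemma open_neq0 U (f : K -> K) : open U -> (forall t, U t -> derivable f t 1) ->
  open (U `&` [set t | f t != 0]).
Proof.
move=> Uo df; rewrite openE => t [Ut ft0].
have Unbhs : nbhs t U by exact: open_nbhs_nbhs.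
have fc : f @ t --> f t.
  by apply/differentiable_continuous/derivable1_diffP; exact: df.
apply: filterI => //.
exact: (cvgr_neq0 _ fc).
Qed.

Section SolutionAtPoint.
Variables (s d : K) (u0 u1 u2 : K -> K) (t : K).
Hypotheses (du0 : is_derive t (1 : K) u0 (u1 t))
  (du1 : is_derive t (1 : K) u1 (u2 t))
  (du2 : is_derive t (1 : K) u2 (chazyIX_rhs d (u0 t) (u1 t))).

Lemma is_derive_tau :
  is_derive t (1 : K) (fun x => tau s (u0 x) (u1 x) (u2 x))
    (dtau s d (u0 t) (u1 t) (u2 t)).
Proof.
rewrite /tau; apply: is_derive_eq.
by rewrite /GRing.scale /= /dtau; ring.
Qed.

Lemma is_derive_dtau :
  is_derive t (1 : K) (fun x => dtau s d (u0 x) (u1 x) (u2 x))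
    (ddtau s d (u0 t) (u1 t) (u2 t)).
Proof.
rewrite /dtau /chazyIX_rhs; apply: is_derive_eq.
by rewrite /GRing.scale /= /ddtau /chazyIX_rhs; ring.
Qed.

Lemma is_derive_riccati1 (y : K -> K) y1 :
  is_derive t (1 : K) y y1 ->
  is_derive t (1 : K) (fun x => riccati1 s (u0 x) (u1 x) (y x))
    (riccati2 s (u0 t) (u1 t) (u2 t) (y t) y1).
Proof.
move=> dy; rewrite /riccati1; apply: is_derive_eq.
by rewrite /GRing.scale /= /riccati2; ring.
Qed.

Lemma is_derive_riccati2 (y y1 : K -> K) y2 :
  is_derive t (1 : K) y (y1 t) -> is_derive t (1 : K) y1 y2 ->
  is_derive t (1 : K)
    (fun x => riccati2 s (u0 x) (u1 x) (u2 x) (y x) (y1 x))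
    (riccati3 s (u0 t) (u1 t) (u2 t) (chazyIX_rhs d (u0 t) (u1 t))
       (y t) (y1 t) y2).
Proof.
move=> dy dy1; rewrite /riccati2; apply: is_derive_eq.
by rewrite /GRing.scale /= /riccati3; ring.
Qed.

Lemma is_derive_g0_lin (f g : K -> K) df dg :
  is_derive t (1 : K) f df -> is_derive t (1 : K) g dg ->
  is_derive t (1 : K) (fun x => g0_lin s (f x) (g x)) (g0_lin s df dg).
Proof. by move=> hf hg; rewrite /g0_lin; apply: is_derive_eq. Qed.

Hypotheses (hs : s ^+ 2 = 5) (tau0 : tau s (u0 t) (u1 t) (u2 t) != 0).
Let y x := dtau s d (u0 x) (u1 x) (u2 x) / tau s (u0 x) (u1 x) (u2 x).

Lemma is_derive_logtau : is_derive t (1 : K) y (riccati1 s (u0 t) (u1 t) (y t)).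
Proof.
have dy := @is_derive_quot (fun x => dtau s d (u0 x) (u1 x) (u2 x))
  (fun x => tau s (u0 x) (u1 x) (u2 x)) _ _ t tau0 is_derive_dtau is_derive_tau.
apply: (@is_derive_eq _ _ _ _ _ _ _ _ dy).
rewrite ddtauE // /riccati1 /y.
by move: (dtau _ _ _ _ _) (tau _ _ _ _) tau0 => n b b0; field.
Qed.

End SolutionAtPoint.

Lemma g0_solution s d U u : s ^+ 2 = 5 -> chazyIX_solution d U u ->
  chazyIX_solution (g0_delta s d) (U `&` g0_dom s u) (g0_fun s d u).
Proof.
move=> hs [Uo su].
have h2 : (2 : K) != 0 by rewrite pnatr_eq0.
have h3 : (3 : K) != 0 by rewrite pnatr_eq0.
set W := U `&` _.
pose u0 := u; pose u1 := derive1n 1 u; pose u2 := derive1n 2 u.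
pose u3 t := chazyIX_rhs d (u0 t) (u1 t).
have du0 t : U t -> is_derive t (1 : K) u0 (u1 t).
  by move=> /su[d0 _ _ _]; exact: is_derive1.
have du1 t : U t -> is_derive t (1 : K) u1 (u2 t).
  by move=> /su[_ d1 _ _]; exact: is_derive1.
have du2 t : U t -> is_derive t (1 : K) u2 (u3 t).
  by move=> /su[_ _ d2 e]; rewrite /u3 -e; exact: is_derive1.
have WE : W = U `&` [set t | tau s (u0 t) (u1 t) (u2 t) != 0].
  by congr (_ `&` _); apply/seteqP; split=> t; rewrite /g0_dom /= g0_den_eq0.
have Wo : open W.
  rewrite WE; apply: open_neq0 => // t Ut; apply: ex_derive.
  exact (is_derive_tau s (du0 _ Ut) (du1 _ Ut) (du2 _ Ut)).
have WU t : W t -> U t by case.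
have W0 t : W t -> tau s (u0 t) (u1 t) (u2 t) != 0 by rewrite WE => -[].
clearbody W => {WE}.
pose y0 t := dtau s d (u0 t) (u1 t) (u2 t) / tau s (u0 t) (u1 t) (u2 t).
pose y1 t := riccati1 s (u0 t) (u1 t) (y0 t).
pose y2 t := riccati2 s (u0 t) (u1 t) (u2 t) (y0 t) (y1 t).
pose y3 t := riccati3 s (u0 t) (u1 t) (u2 t) (u3 t) (y0 t) (y1 t) (y2 t).
have dy0 t : W t -> is_derive t (1 : K) y0 (y1 t).
  move=> Wt; have Ut := WU _ Wt.
  exact (is_derive_logtau (du0 _ Ut) (du1 _ Ut) (du2 _ Ut) hs (W0 _ Wt)).
have dy1 t : W t -> is_derive t (1 : K) y1 (y2 t).
  move=> Wt; have Ut := WU _ Wt.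
  exact (is_derive_riccati1 s (du0 _ Ut) (du1 _ Ut) (dy0 _ Wt)).
have dy2 t : W t -> is_derive t (1 : K) y2 (y3 t).
  move=> Wt; have Ut := WU _ Wt.
  exact (is_derive_riccati2 s (du0 _ Ut) (du1 _ Ut) (du2 _ Ut)
           (dy0 _ Wt) (dy1 _ Wt)).
pose p0 t := g0_lin s (u0 t) (y0 t); pose p1 t := g0_lin s (u1 t) (y1 t).
pose p2 t := g0_lin s (u2 t) (y2 t); pose p3 t := g0_lin s (u3 t) (y3 t).
have dp0 t : W t -> is_derive t (1 : K) p0 (p1 t).
  move=> Wt; have Ut := WU _ Wt.
  exact (is_derive_g0_lin s (du0 _ Ut) (dy0 _ Wt)).
have dp1 t : W t -> is_derive t (1 : K) p1 (p2 t).
  move=> Wt; have Ut := WU _ Wt.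
  exact (is_derive_g0_lin s (du1 _ Ut) (dy1 _ Wt)).
have dp2 t : W t -> is_derive t (1 : K) p2 (p3 t).
  move=> Wt; have Ut := WU _ Wt.
  exact (is_derive_g0_lin s (du2 _ Ut) (dy2 _ Wt)).
have e0 t : W t -> g0_fun s d u t = p0 t.
  by move=> /W0 t0; rewrite /g0_fun g0_pE.
have q0 := derive1_eq_on Wo e0 dp0.
have q1 := derive1_eq_on Wo (fun t Wt => (q0 t Wt).2) dp1.
have q2 := derive1_eq_on Wo (fun t Wt => (q1 t Wt).2) dp2.
split; first exact: Wo.
move=> t Wt.
have [d0 f1] := q0 t Wt; have [d1 f2] := q1 t Wt; have [d2 f3] := q2 t Wt.
split; [exact: d0 | exact: d1 | exact: d2 | rewrite [LHS]f3].
rewrite [derive1n 1 _ t]f1 e0 //.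
have yt : y0 t * tau s (u0 t) (u1 t) (u2 t) = dtau s d (u0 t) (u1 t) (u2 t).
  by rewrite divfK // W0.
exact: (g0_lin_chazyIX hs h2 h3 yt).
Qed.

End Analytic.

(** * Evaluation of fractions along a ring morphism *)

Lemma fracE (R : idomainType) (f : {fraction R}) :
  f = FracField.tofrac (repr f).1 / FracField.tofrac (repr f).2.
Proof.
elim/quotW: f => x; set r := repr _.
have d0 : FracField.tofrac r.2 != 0 by rewrite tofrac_eq0 denom_ratioP.
apply: (mulIf d0); rewrite mulfVK // -[X in X * _]reprK -/r !piE.
apply/eqmodP; rewrite /= FracField.equivfE /FracField.mulf.
rewrite !numden_Ratio ?mulf_neq0 ?oner_neq0 ?denom_ratioP //.
by rewrite !mulr1 mulrC.
Qed.

Lemma fracP (R : idomainType) (f : {fraction R}) :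
  exists a b : R, b != 0 /\ f = FracField.tofrac a / FracField.tofrac b.
Proof.
by exists (repr f).1, (repr f).2; split; [exact: denom_ratioP | exact: fracE].
Qed.

Section Specialization.
Variables (R : idomainType) (L : fieldType) (phi : {rmorphism R -> L}).
Implicit Types (f g : {fraction R}) (v w : L).
Local Notation fr := (@FracField.tofrac R).

(** The graph of the extension of [phi] to the localization of R at the kernel
    of [phi].  A relation avoids choosing a denominator on which [phi] does not
    vanish, and makes sense when [phi] is not injective. *)
Definition specializes f v := exists a b,
  [/\ f = fr a / fr b, phi b != 0 & v = phi a / phi b].

Lemma morph_neq0 b : phi b != 0 -> fr b != 0.
Proof. by rewrite tofrac_eq0; apply: contra_neq => ->; rewrite rmorph0. Qed.

Lemma specializes_tofrac h : specializes (fr h) (phi h).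
Proof. by exists h, 1; rewrite !rmorph1 oner_neq0 !divr1. Qed.

Lemma specializesD f g v w :
  specializes f v -> specializes g w -> specializes (f + g) (v + w).
Proof.
move=> [a [b [-> b0 ->]]] [a' [b' [-> b0' ->]]].
exists (a * b' + a' * b), (b * b').
by rewrite !rmorphD !rmorphM !addf_div ?morph_neq0 // mulf_neq0.
Qed.

Lemma specializesM f g v w :
  specializes f v -> specializes g w -> specializes (f * g) (v * w).
Proof.
move=> [a [b [-> b0 ->]]] [a' [b' [-> b0' ->]]].
by exists (a * a'), (b * b'); rewrite !mulf_div !rmorphM mulf_neq0.
Qed.

Lemma specializes_unique f v w : specializes f v -> specializes f w -> v = w.
Proof.
move=> [a [b [-> b0 ->]]] [a' [b' [e b0' ->]]].
apply/eqP; rewrite eqr_div // -!rmorphM; apply/eqP; congr (phi _).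
by apply/eqP; rewrite -tofrac_eq !rmorphM -eqr_div ?morph_neq0 // e.
Qed.

Lemma specializes0 v : specializes 0 v -> v = 0.
Proof.
move=> s0v; apply: (specializes_unique s0v).
by have := specializes_tofrac 0; rewrite tofrac0 rmorph0.
Qed.

Lemma specializes_repr f : phi (repr f).2 != 0 ->
  specializes f (phi (repr f).1 / phi (repr f).2).
Proof. by move=> f0; exists (repr f).1, (repr f).2; rewrite -fracE. Qed.

End Specialization.

(** * Substitution of rational functions into polynomials *)

Section RationalSubstitution.
Variable F : fieldType.

Section RatC.
Variable n : nat.

Lemma ratC_is_zmod_morphism : zmod_morphism (@ratC F n).
Proof. by move=> a b; rewrite /ratC !rmorphB. Qed.

Lemma ratC_is_monoid_morphism : monoid_morphism (@ratC F n).
Proof. by split=> [|a b]; rewrite /ratC ?rmorph1 ?rmorphM. Qed.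

HB.instance Definition _ :=
  GRing.isZmodMorphism.Build F (ratfun F n) (@ratC F n) ratC_is_zmod_morphism.
HB.instance Definition _ :=
  GRing.isMonoidMorphism.Build F (ratfun F n) (@ratC F n)
    ratC_is_monoid_morphism.

Lemma ratC_nat_neq0 k : k%:R != 0 :> F -> k%:R != 0 :> ratfun F n.
Proof. by move=> k0; rewrite -(rmorph_nat (@ratC F n)) fmorph_eq0. Qed.

End RatC.

Section PolyComp.
Variables (m n : nat) (P : 'I_m -> ratfun F n).

Lemma poly_comp_is_zmod_morphism : zmod_morphism (poly_comp P).
Proof. by move=> g h; rewrite /poly_comp mmapB. Qed.

Lemma poly_comp_is_monoid_morphism : monoid_morphism (poly_comp P).
Proof.
rewrite /poly_comp; split; first exact: rmorph1.
by move=> g h; rewrite rmorphM.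
Qed.

HB.instance Definition _ :=
  GRing.isZmodMorphism.Build (mpoly m F) (ratfun F n) (poly_comp P)
    poly_comp_is_zmod_morphism.
HB.instance Definition _ :=
  GRing.isMonoidMorphism.Build (mpoly m F) (ratfun F n) (poly_comp P)
    poly_comp_is_monoid_morphism.

Lemma poly_compC c : poly_comp P (mpolyC m c) = ratC n c.
Proof. exact: mmapC. Qed.

Lemma poly_compX i : poly_comp P (mpolyX F (mnm1 i)) = P i.
Proof. by rewrite /poly_comp mmapX mmap1U. Qed.

End PolyComp.

Lemma mpoly_gen_ind (n : nat) (T : mpoly n F -> Prop) :
  (forall c, T (mpolyC n c)) -> (forall i, T (mpolyX F (mnm1 i))) ->
  (forall p q, T p -> T q -> T (p + q)) ->
  (forall p q, T p -> T q -> T (p * q)) -> forall p, T p.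
Proof.
move=> TC TX TD TM; elim/mpolyind => [|c m p _ _ Tp].
  by rewrite -(mpolyC0 n F); apply: TC.
apply: TD => //; rewrite -mul_mpolyC; apply: (TM _ _ (TC c)).
have T1 : T 1 by exact: TC.
rewrite mpolyXE_id; apply: big_ind => // i _.
by elim: (m i) => [|k IHk]; rewrite ?expr0 // exprS; apply: TM.
Qed.

Lemma specializes_rat_comp m n (P : 'I_m -> ratfun F n) f v :
  dominant P -> specializes (poly_comp P) f v -> rat_comp P f = v.
Proof.
move=> domP fv; apply: (specializes_unique _ fv); apply: specializes_repr.
exact: domP (denom_ratioP _).
Qed.

(** Evaluation along Q sends h(P) to h; if h(P) = 0, it sends 0 to h, and
    h = 0.  The only divisions are those by the denominators of P, which Q does
    not annihilate by assumption. *)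
Lemma specializes_dominant n m (P : 'I_m -> ratfun F n)
    (Q : 'I_n -> ratfun F m) :
  (forall i, specializes (poly_comp Q) (P i) (ratX F i)) -> dominant P.
Proof.
move=> PQ h; apply: contra_neq => Ph.
suff : specializes (poly_comp Q) (poly_comp P h) (FracField.tofrac h).
  by rewrite Ph => /specializes0 /eqP; rewrite tofrac_eq0 => /eqP.
elim/mpoly_gen_ind: h {Ph} => [c|i|p q IHp IHq|p q IHp IHq].
- rewrite poly_compC; have := specializes_tofrac (poly_comp Q) (mpolyC n c).
  by rewrite /= poly_compC.
- by rewrite poly_compX.
- by rewrite !rmorphD; apply: specializesD.
- by rewrite !rmorphM; apply: specializesM.
Qed.

End RationalSubstitution.

(** * The derivation of the field of rational functions *)

Section MorphismImages.
Variables (A B : comNzRingType) (f : {rmorphism A -> B}).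

Lemma chazyIX_rhs_morph d u0 u1 :
  f (chazyIX_rhs d u0 u1) = chazyIX_rhs (f d) (f u0) (f u1).
Proof. by rewrite /chazyIX_rhs !(rmorphD, rmorphM, rmorphXn, rmorph_nat). Qed.

Lemma tau_morph s u0 u1 u2 :
  f (tau s u0 u1 u2) = tau (f s) (f u0) (f u1) (f u2).
Proof. by rewrite /tau !(rmorphD, rmorphN, rmorphM, rmorph_nat, rmorph1). Qed.

Lemma g0_num_morph s d u0 u1 u2 :
  f (g0_num s d u0 u1 u2) = g0_num (f s) (f d) (f u0) (f u1) (f u2).
Proof.
by rewrite /g0_num
  !(rmorphD, rmorphN, rmorphM, rmorphXn, rmorph_nat, rmorph1).
Qed.

Lemma g0_den_morph s u0 u1 u2 :
  f (g0_den s u0 u1 u2) = g0_den (f s) (f u0) (f u1) (f u2).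
Proof.
by rewrite /g0_den !(rmorphD, rmorphN, rmorphM, rmorph_nat, rmorph1).
Qed.

End MorphismImages.

Lemma coord_eq j k : (j < 3)%N -> (k < 3)%N ->
  (Defs.coord j == Defs.coord k) = (j == k).
Proof. by move=> j3 k3; rewrite -val_eqE /= !inordK. Qed.

Lemma coord_ind (T : 'I_3 -> Prop) :
  T (Defs.coord 0) -> T (Defs.coord 1) -> T (Defs.coord 2) -> forall i, T i.
Proof.
move=> T0 T1 T2 i.
have -> : i = Defs.coord i by apply: val_inj; rewrite /= inordK.
by case: i => [[|[|[|//]]] ?].
Qed.

Lemma quotient_product_rule (L : fieldType) (a b a' b' da db da' db' : L) :
  b != 0 -> b' != 0 ->
  ((da * a' + a * da') * (b * b') - (a * a') * (db * b' + b * db'))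
    / (b * b') ^+ 2
  = (da * b - a * db) / b ^+ 2 * (a' / b')
    + a / b * ((da' * b' - a' * db') / b' ^+ 2).
Proof. by move=> b0 b0'; field; rewrite b0 b0'. Qed.

Section RationalDerivation.
Variables (F : fieldType) (d : F).
Local Notation X k := (mpolyX F (mnm1 (Defs.coord k))).
Local Notation x k := (ratX F (Defs.coord k)).
Local Notation D := (chazyIX_poly_deriv d).
Local Notation del := (chazyIX_deriv d).
Local Notation fr := (@FracField.tofrac (mpoly 3 F)).

Lemma poly_derivD : {morph D : g h / g + h}.
Proof. by move=> g h; rewrite /chazyIX_poly_deriv !mderivD; ring. Qed.

Lemma poly_derivM g h : D (g * h) = D g * h + g * D h.
Proof. by rewrite /chazyIX_poly_deriv !mderivM; ring. Qed.

Lemma poly_derivC c : D (mpolyC 3 c) = 0.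
Proof. by rewrite /chazyIX_poly_deriv !mderivC !mulr0 !addr0. Qed.

Lemma mderiv_var (i j : 'I_3) : mderiv i (mpolyX F (mnm1 j)) = (i == j)%:R.
Proof.
rewrite mderivX mnm1E eq_sym; have [->|_] := eqVneq i j; last first.
  by rewrite scale0r.
rewrite scale1r -[RHS](mpolyX0 3 F); congr mpolyX.
by apply/mnmP=> k; rewrite mnmBE subnn mnm0E.
Qed.

Lemma poly_derivX0 : D (X 0) = X 1.
Proof.
rewrite /chazyIX_poly_deriv !mderiv_var !coord_eq //=.
by rewrite mulr1 !mulr0 !addr0.
Qed.

Lemma poly_derivX1 : D (X 1) = X 2.
Proof.
rewrite /chazyIX_poly_deriv !mderiv_var !coord_eq //=.
by rewrite mulr1 !mulr0 add0r addr0.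
Qed.

Lemma poly_derivX2 : D (X 2) = chazyIX_rhs (mpolyC 3 d) (X 0) (X 1).
Proof.
rewrite /chazyIX_poly_deriv !mderiv_var !coord_eq //=.
by rewrite mulr1 !mulr0 !add0r.
Qed.

(** The derivation does not depend on the fraction that represents its
    argument: differentiate the equality of the cross products. *)
Lemma ratderiv_frac a b : b != 0 ->
  del (fr a / fr b) = fr (D a * b - a * D b) / fr (b ^+ 2).
Proof.
move=> b0; rewrite /chazyIX_deriv.
set f := fr a / fr b; set n := (repr f).1; set m := (repr f).2.
have m0 : m != 0 by exact: denom_ratioP.
have e : n * b = a * m.
  apply/eqP; rewrite -tofrac_eq !rmorphM /=.
  by rewrite -eqr_div ?tofrac_eq0 // -fracE.
have De : D n * b + n * D b = D a * m + a * D m by rewrite -!poly_derivM e.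
apply/eqP; rewrite eqr_div ?tofrac_eq0 ?expf_neq0 // -!rmorphM tofrac_eq /=.
rewrite -subr_eq0; set lhs := (X in X == 0).
have -> : lhs = (D n * b + n * D b - (D a * m + a * D m)) * m * b
                - (n * b - a * m) * (D m * b + D b * m) by rewrite /lhs; ring.
by rewrite De e !subrr !mul0r subrr.
Qed.

Lemma ratderiv_tofrac a : del (fr a) = fr (D a).
Proof.
have -> : fr a = fr a / fr 1 by rewrite tofrac1 divr1.
rewrite ratderiv_frac ?oner_neq0 // -(mpolyC1 3 F) poly_derivC mpolyC1.
by rewrite mulr1 mulr0 subr0 expr1n tofrac1 divr1.
Qed.

Lemma ratderivC c : del (ratC 3 c) = 0.
Proof. by rewrite /ratC ratderiv_tofrac poly_derivC tofrac0. Qed.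

Lemma ratderivX0 : del (x 0) = x 1.
Proof. by rewrite /ratX ratderiv_tofrac poly_derivX0. Qed.

Lemma ratderivX1 : del (x 1) = x 2.
Proof. by rewrite /ratX ratderiv_tofrac poly_derivX1. Qed.

Lemma ratderivX2 : del (x 2) = chazyIX_rhs (ratC 3 d) (x 0) (x 1).
Proof. by rewrite /ratX ratderiv_tofrac poly_derivX2 chazyIX_rhs_morph. Qed.

Lemma ratderivD : {morph del : f g / f + g}.
Proof.
move=> f g.
have [a [b [b0 ->]]] := fracP f; have [a' [b' [b0' ->]]] := fracP g.
rewrite addf_div ?tofrac_eq0 // -!rmorphM -rmorphD !ratderiv_frac ?mulf_neq0 //.
rewrite addf_div ?tofrac_eq0 ?expf_neq0 // -!rmorphM -rmorphD /=.
by rewrite poly_derivD !poly_derivM; congr (fr _ / fr _); ring.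
Qed.

Lemma ratderivM f g : del (f * g) = del f * g + f * del g.
Proof.
have [a [b [b0 ->]]] := fracP f; have [a' [b' [b0' ->]]] := fracP g.
rewrite mulf_div -!rmorphM !ratderiv_frac ?mulf_neq0 // !poly_derivM.
(* D a is convertible to a sum, which tofracD would expand. *)
move: (D a) (D b) (D a') (D b') b0 b0' => da db da' db' b0 b0'.
rewrite !(tofracXn, tofracB, tofracD, tofracM).
by apply: quotient_product_rule; rewrite tofrac_eq0.
Qed.

End RationalDerivation.

Section ChainRule.
Variables (F : fieldType) (d d' : F) (P : 'I_3 -> ratfun F 3).

(** P is the 2-jet of a function which, for the derivation of the equation with
    parameter d, solves the equation with parameter d'. *)
Definition solution_jet :=
  let p k := P (Defs.coord k) in
  [/\ chazyIX_deriv d (p 0%N) = p 1%N, chazyIX_deriv d (p 1%N) = p 2%N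
    & chazyIX_deriv d (p 2%N) = chazyIX_rhs (ratC 3 d') (p 0%N) (p 1%N)].

Hypothesis jetP : solution_jet.

Lemma ratderiv_poly_comp h :
  chazyIX_deriv d (poly_comp P h) = poly_comp P (chazyIX_poly_deriv d' h).
Proof.
have [P0 P1 P2] := jetP.
elim/mpoly_gen_ind: h => [c|i|p q IHp IHq|p q IHp IHq].
- by rewrite poly_compC ratderivC poly_derivC rmorph0.
- rewrite poly_compX; elim/coord_ind: i.
  + by rewrite P0 poly_derivX0 poly_compX.
  + by rewrite P1 poly_derivX1 poly_compX.
  + by rewrite P2 poly_derivX2 chazyIX_rhs_morph /= poly_compC !poly_compX.
- by rewrite rmorphD ratderivD IHp IHq poly_derivD [RHS]rmorphD.
- rewrite [poly_comp P (p * q)]rmorphM ratderivM IHp IHq poly_derivM.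
  by rewrite [RHS]rmorphD [X in _ = X + _]rmorphM [X in _ = _ + X]rmorphM.
Qed.

Lemma specializes_ratderiv f v : specializes (poly_comp P) f v ->
  specializes (poly_comp P) (chazyIX_deriv d' f) (chazyIX_deriv d v).
Proof.
move=> [a [b [-> Pb ->]]].
have b0 : b != 0 by rewrite -tofrac_eq0 (morph_neq0 Pb).
exists (chazyIX_poly_deriv d' a * b - a * chazyIX_poly_deriv d' b), (b ^+ 2).
split; first exact: ratderiv_frac.
  by rewrite rmorphXn /= expf_neq0.
rewrite (del_quot (@ratderivM F d) _ Pb) !ratderiv_poly_comp.
move: (chazyIX_poly_deriv d' a) (chazyIX_poly_deriv d' b) => a' b'.
by rewrite rmorphXn rmorphB !rmorphM.
Qed.

End ChainRule.

(** * Birationality of the induced map *)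

Section G0Map.
Variable F : fieldType.
Local Notation x k := (ratX F (Defs.coord k)).

Lemma g0_map_iter (s d : F) k : (k < 3)%N ->
  g0_map s d (Defs.coord k) =
  iter k (chazyIX_deriv d) (g0_map s d (Defs.coord 0)).
Proof. by move=> k3; rewrite /g0_map !inordK. Qed.

Section Inverse.
Variables s d : F.
Hypotheses (hs : s ^+ 2 = 5) (h2 : (2 : F) != 0) (h3 : (3 : F) != 0).
Local Notation P := (g0_map s d).
Local Notation p k := (P (Defs.coord k)).

(** It takes the value 1 at the point (0, 0, 1). *)
Lemma tau_generic_neq0 : tau (ratC 3 s) (x 0) (x 1) (x 2) != 0.
Proof.
rewrite /ratC /ratX -tau_morph tofrac_eq0; set t := tau _ _ _ _.
pose e (i : 'I_3) : ratfun F 3 := (i == Defs.coord 2)%:R.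
suff : poly_comp e t != 0 by apply: contra_neq => ->; rewrite rmorph0.
rewrite tau_morph /= !poly_compX /e !coord_eq //=.
by rewrite /tau mulr0 add0r oner_neq0.
Qed.

Lemma g0_delta_ratC : ratC 3 (g0_delta s d) = g0_delta (ratC 3 s) (ratC 3 d).
Proof.
by rewrite /g0_delta rmorphM fmorph_div rmorphD rmorphM !rmorph_nat.
Qed.

Lemma g0_map_spec :
  [/\ solution_jet d (g0_delta s d) P,
      tau (ratC 3 (- s)) (p 0) (p 1) (p 2) != 0
    & g0_p (ratC 3 (- s)) (ratC 3 (g0_delta s d)) (p 0) (p 1) (p 2) = x 0].
Proof.
have hS : ratC 3 s ^+ 2 = 5 by rewrite -rmorphXn /= hs rmorph_nat.
have [p3 t0 q0] :=
  g0_p_derivation (@ratderivD F d) (@ratderivM F d) (ratderivC d s)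
    (ratderivC d d) (ratderivX0 d) (ratderivX1 d) (ratderivX2 d) hS
    (ratC_nat_neq0 3 h2) (ratC_nat_neq0 3 h3) tau_generic_neq0.
have P0 : p 0 = g0_p (ratC 3 s) (ratC 3 d) (x 0) (x 1) (x 2).
  by rewrite /g0_map inordK.
have P1 := @g0_map_iter s d 1 isT; have P2 := @g0_map_iter s d 2 isT.
rewrite P0 in P1 P2.
have nS : ratC 3 (- s) = - ratC 3 s by exact: rmorphN.
rewrite /solution_jet nS g0_delta_ratC P0 P1 P2.
split; [split; [reflexivity | reflexivity | exact: p3] | exact: t0 | exact: q0].
Qed.

Lemma specializes_g0_map0 :
  specializes (poly_comp P) (g0_map (- s) (g0_delta s d) (Defs.coord 0)) (x 0).
Proof.
have [_ t0 <-] := g0_map_spec.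
pose X k : mpoly 3 F := mpolyX F (mnm1 (Defs.coord k)).
exists (g0_num (mpolyC 3 (- s)) (mpolyC 3 (g0_delta s d)) (X 0) (X 1) (X 2)).
exists (g0_den (mpolyC 3 (- s)) (X 0) (X 1) (X 2)).
rewrite !g0_num_morph !g0_den_morph /= !poly_compC !poly_compX.
split; [by rewrite /g0_map inordK | | reflexivity].
have hS : ratC 3 (- s) ^+ 2 = 5 by rewrite -rmorphXn /= sqrrN hs rmorph_nat.
rewrite (g0_den_eq0 _ _ _ hS (ratC_nat_neq0 3 h2) (ratC_nat_neq0 3 h3)).
exact: t0.
Qed.

(** The conjugate map inverts the first coordinate; differentiating this
    identity settles the two others. *)
Lemma specializes_g0_map i :
  specializes (poly_comp P) (g0_map (- s) (g0_delta s d) i) (ratX F i).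
Proof.
have [jP _ _] := g0_map_spec.
have s0 := specializes_g0_map0.
have s1 := specializes_ratderiv jP s0; rewrite ratderivX0 in s1.
have s2 := specializes_ratderiv jP s1; rewrite ratderivX1 in s2.
elim/coord_ind: i; first exact: s0.
- by rewrite (@g0_map_iter _ _ 1 isT).
- by rewrite (@g0_map_iter _ _ 2 isT).
Qed.

End Inverse.

Lemma birational_g0_map (s d : F) :
  s ^+ 2 = 5 -> (2 : F) != 0 -> (3 : F) != 0 -> birational_map (g0_map s d).
Proof.
move=> hs h2 h3; have hs' : (- s) ^+ 2 = 5 by rewrite sqrrN.
have PQ := specializes_g0_map d hs h2 h3.
have QP := specializes_g0_map (g0_delta s d) hs' h2 h3.
rewrite opprK g0_delta_conj // in QP.
have domP := specializes_dominant QP; have domQ := specializes_dominant PQ.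
exists (g0_map (- s) (g0_delta s d)); split=> // i.
  exact: specializes_rat_comp domP (PQ i).
exact: specializes_rat_comp domQ (QP i).
Qed.

End G0Map.

Theorem theorem9p3 (R : realType) (delta : Cplx R) :
  let sqrt5 : Cplx R := sqrtC 5 in
  (forall (U : set (Cplx R)) (u : Cplx R -> Cplx R),
     chazyIX_solution delta U u ->
     chazyIX_solution (g0_delta sqrt5 delta) (U `&` g0_dom sqrt5 u)
       (g0_fun sqrt5 delta u))
  /\ birational_map (g0_map sqrt5 delta).
Proof.
move=> s; have hs : s ^+ 2 = 5 by exact: sqrtCK.
split; first by move=> U u; exact: g0_solution.
by apply: birational_g0_map; rewrite ?pnatr_eq0.
Qed.
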